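(* Let $Z=m_1P_1+\cdots+m_sP_s\subseteq\mathbb{P}^1\times\mathbb{P}^1$ be a set of fat points whose support $\{P_1,\dots,P_s\}$ is in generic position. Assume $m_1\geq m_2\geq\cdots\geq m_s$, and set $m=m_1+m_2+\cdots+m_s$. Then \[\{(i,j)\in\mathbb{N}^2\mid (i,j)\geq(m_1-1,m_1-1)\ \text{and}\ i+j\geq\max\{m-1,2m_1-2\}\}\subseteq\operatorname{reg}_B(Z).\]
   Context: Let $\mathbf{k}$ be an algebraically closed field of characteristic zero. The homogeneous coordinate ring of $\mathbb{P}^1\times\mathbb{P}^1$ is $R=\mathbf{k}[x_0,x_1,y_0,y_1]$, graded by $\mathbb{N}^2$ with $\deg x_i=(1,0)$, $\deg y_i=(0,1)$ ($\mathbb{N}$ contains $0$); its irrelevant ideal is $B=\langle x_0,x_1\rangle\cap\langle y_0,y_1\rangle$. For a point $P$, $I_P\subseteq R$ is its defining prime ideal. Given distinct points $P_1,\dots,P_s$ ($s\ge1$) and positive integers $m_1,\dots,m_s$, the set (scheme) of fat points $Z=m_1P_1+\cdots+m_sP_s$ is defined by $I_Z=I_{P_1}^{m_1}\cap\cdots\cap I_{P_s}^{m_s}$. The support $X=\{P_1,\dots,P_s\}$ is in generic position if $\dim_{\mathbf{k}}(R/I_X)_{(i,j)}=\min\{\dim_{\mathbf{k}}R_{(i,j)},s\}$ for all $(i,j)\in\mathbb{N}^2$, where $I_X=I_{P_1}\cap\cdots\cap I_{P_s}$. Inequalities between vectors are coordinatewise. For $i\in\mathbb{Z}$, $\mathbb{N}^2[i]:=\bigcup(\operatorname{sign}(i)\underline{q}+\mathbb{N}^2)\subset\mathbb{Z}^2$,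 the union over all $\underline{q}\in\mathbb{N}^2$ whose coordinates sum to $|i|$ (so $\mathbb{N}^2[0]=\mathbb{N}^2$). For a finitely generated $\mathbb{N}^2$-graded $R$-module $M$ and $\underline{m}\in\mathbb{Z}^2$, $M$ is $\underline{m}$-regular if $H^i_B(M)_{\underline{p}}=0$ for all $i\ge0$ and all $\underline{p}\in\underline{m}+\mathbb{N}^2[1-i]$, where $H^i_B$ is local cohomology with support in $B$. $\operatorname{reg}_B(M)\subseteq\mathbb{Z}^2$ is the set of all $\underline{m}$ for which $M$ is $\underline{m}$-regular, and $\operatorname{reg}_B(Z):=\operatorname{reg}_B(R/I_Z)$. *)

(* Defs.v *)
From HB Require Import structures.
From mathcomp Require Import all_boot all_order all_algebra.
From mathcomp Require Import generic_quotient ring_quotient.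
From mathcomp Require Import boolp zify.
From mathcomp Require Import mpoly.

Set Implicit Arguments.
Unset Strict Implicit.
Unset Printing Implicit Defensive.

Import Order.TTheory GRing.Theory Num.Theory.
Local Open Scope ring_scope.
Local Open Scope quotient_scope.

Record submodule (R : comNzRingType) (M : lmodType R) := Submodule {
  submodule_pred :> {pred M};
  submodule_closed : submod_closed submodule_pred
}.

HB.instance Definition _ (R : comNzRingType) (M : lmodType R)
    (N : submodule M) :=
  GRing.isSubmodClosed.Build R M (submodule_pred N) (submodule_closed N).

Section QuotientModule.
Variables (R : comNzRingType) (M : lmodType R) (N : submodule M).

Definition quot_scale (a : R) : {ideal_quot N} -> {ideal_quot N} :=
  fun x => \pi_{ideal_quot N} (a *: repr x).

Lemma quot_scaleE (a : R) (u : M) :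
  quot_scale a (\pi u) = \pi_{ideal_quot N} (a *: u).
Proof.
apply/eqP; rewrite /quot_scale -Quotient.idealrBE -scalerBr rpredZ //.
by rewrite Quotient.idealrBE reprK.
Qed.

Fact quot_scaleA a b x : quot_scale a (quot_scale b x) = quot_scale (a * b) x.
Proof.
by elim/quotW: x => u; rewrite (quot_scaleE b) !quot_scaleE scalerA.
Qed.

Fact quot_scale1 : left_id 1 quot_scale.
Proof. by elim/quotW=> u; rewrite quot_scaleE scale1r. Qed.

Fact quot_scaleDr : right_distributive quot_scale +%R.
Proof.
move=> a; elim/quotW=> u; elim/quotW=> v.
by rewrite -raddfD !quot_scaleE -raddfD scalerDr.
Qed.

Fact quot_scaleDl x : {morph quot_scale^~ x : a b / a + b}.
Proof.
by elim/quotW: x => u a b; rewrite !quot_scaleE -raddfD scalerDl.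
Qed.

HB.instance Definition _ := GRing.Zmodule_isLmodule.Build R {ideal_quot N}
  quot_scaleA quot_scale1 quot_scaleDr quot_scaleDl.

End QuotientModule.

(* The localization M_g: classes of pairs (u, a), standing for u / g ^ a. *)
Section Localization.
Variables (R : comNzRingType) (M : lmodType R) (g : R).

Definition loc_equiv (x y : M * nat) : bool :=
  `[< exists c, g ^+ (c + y.2) *: x.1 = g ^+ (c + x.2) *: y.1 >].

Fact loc_equiv_is_equiv : equiv_class_of loc_equiv.
Proof.
split=> [x|x y|y x z].
- by apply/asboolP; exists 0%N.
- by apply/asboolP/asboolP=> -[c e]; exists c.
move=> /asboolP[c e] /asboolP[d f]; apply/asboolP; exists (c + d + y.2)%N.
have := congr1 (fun u => g ^+ (d + z.2) *: u) e.
have := congr1 (fun u => g ^+ (c + x.2) *: u) f.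
rewrite /= !scalerA -!exprD => f' e'.
rewrite (_ : c + d + y.2 + z.2 = d + z.2 + (c + y.2))%N; last lia.
rewrite e' (_ : d + z.2 + (c + x.2) = c + x.2 + (d + z.2))%N; last lia.
by rewrite f'; congr (g ^+ _ *: _); lia.
Qed.

Canonical loc_equiv_equiv := EquivRelPack loc_equiv_is_equiv.
Canonical loc_equiv_encModRel := defaultEncModRel loc_equiv.

Definition loc := {eq_quot loc_equiv}.

HB.instance Definition _ : EqQuotient _ loc_equiv loc := EqQuotient.on loc.
HB.instance Definition _ := Choice.on loc.

Definition frac (u : M) (a : nat) : loc := \pi_loc (u, a).

Lemma fracP (u v : M) a b :
  frac u a = frac v b <->
  exists c, g ^+ (c + b) *: u = g ^+ (c + a) *: v.
Proof.
split=> [/eqP|h]; first by rewrite piE => /asboolP.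
by apply/eqP; rewrite piE; apply/asboolP.
Qed.

Lemma fracK (x : loc) : frac (repr x).1 (repr x).2 = x.
Proof. by rewrite /frac -surjective_pairing reprK. Qed.

Lemma frac_ind (T : loc -> Prop) : (forall u a, T (frac u a)) -> forall x, T x.
Proof. by move=> h x; rewrite -[x]fracK. Qed.

Lemma frac_repr u a : exists c,
  g ^+ (c + a) *: (repr (frac u a)).1 = g ^+ (c + (repr (frac u a)).2) *: u.
Proof. by apply/fracP; rewrite fracK. Qed.

Definition loc_add (x y : loc) : loc :=
  let: (u, a) := repr x in let: (v, b) := repr y in
  frac (g ^+ b *: u + g ^+ a *: v) (a + b).

Definition loc_opp (x : loc) : loc := let: (u, a) := repr x in frac (- u) a.

Definition loc_scale (r : R) (x : loc) : loc :=
  let: (u, a) := repr x in frac (r *: u) a.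

Lemma loc_addE u a v b :
  loc_add (frac u a) (frac v b) = frac (g ^+ b *: u + g ^+ a *: v) (a + b).
Proof.
rewrite /loc_add; have [c] := frac_repr u a; have [d] := frac_repr v b.
case: (repr (frac u a)) => u' a'; case: (repr (frac v b)) => v' b' /= f e.
apply/fracP; exists (c + d)%N.
have := congr1 (fun w => g ^+ (d + b + b') *: w) e.
have := congr1 (fun w => g ^+ (c + a + a') *: w) f.
rewrite /= !scalerDr !scalerA -!exprD => f' e'.
congr (_ + _).
  rewrite (_ : c + d + (a + b) + b' = d + b + b' + (c + a))%N; last lia.
  by rewrite e'; congr (g ^+ _ *: _); lia.
rewrite (_ : c + d + (a + b) + a' = c + a + a' + (d + b))%N; last lia.
by rewrite f'; congr (g ^+ _ *: _); lia.
Qed.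

Lemma loc_oppE u a : loc_opp (frac u a) = frac (- u) a.
Proof.
rewrite /loc_opp; have [c] := frac_repr u a.
case: (repr (frac u a)) => u' a' /= e.
by apply/fracP; exists c; rewrite !scalerN e.
Qed.

Lemma loc_scaleE r u a : loc_scale r (frac u a) = frac (r *: u) a.
Proof.
rewrite /loc_scale; have [c] := frac_repr u a.
case: (repr (frac u a)) => u' a' /= e.
by apply/fracP; exists c; rewrite !scalerA ![_ * r]mulrC -!scalerA e.
Qed.

Fact loc_addA : associative loc_add.
Proof.
elim/frac_ind=> u a; elim/frac_ind=> v b; elim/frac_ind=> w c.
rewrite !loc_addE addnA !scalerDr !scalerA -!exprD addrA.
by rewrite [(c + b)%N]addnC [(c + a)%N]addnC.
Qed.

Fact loc_addC : commutative loc_add.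
Proof.
by elim/frac_ind=> u a; elim/frac_ind=> v b; rewrite !loc_addE addrC addnC.
Qed.

Fact loc_add0 : left_id (frac 0 0) loc_add.
Proof.
by elim/frac_ind=> u a; rewrite loc_addE scaler0 add0r expr0 scale1r.
Qed.

Fact loc_addN : left_inverse (frac 0 0) loc_opp loc_add.
Proof.
elim/frac_ind=> u a; rewrite loc_oppE loc_addE scalerN addNr.
by apply/fracP; exists 0%N; rewrite !scaler0.
Qed.

HB.instance Definition _ :=
  GRing.isZmodule.Build loc loc_addA loc_addC loc_add0 loc_addN.

Lemma frac0 a : frac 0 a = 0.
Proof. by apply/fracP; exists 0%N; rewrite !scaler0. Qed.

Lemma fracD u a v b :
  frac u a + frac v b = frac (g ^+ b *: u + g ^+ a *: v) (a + b).
Proof. exact: loc_addE. Qed.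

Lemma frac_cancel c u a : frac (g ^+ c *: u) (c + a) = frac u a.
Proof.
by apply/fracP; exists 0%N; rewrite scalerA -exprD; congr (g ^+ _ *: _); lia.
Qed.

Lemma fracDl u v a : frac (u + v) a = frac u a + frac v a.
Proof. by rewrite fracD -scalerDr frac_cancel. Qed.

Fact loc_scaleA r t x : loc_scale r (loc_scale t x) = loc_scale (r * t) x.
Proof. by elim/frac_ind: x => u a; rewrite !loc_scaleE scalerA. Qed.

Fact loc_scale1 : left_id 1 loc_scale.
Proof. by elim/frac_ind=> u a; rewrite loc_scaleE scale1r. Qed.

Fact loc_scaleDr : right_distributive loc_scale +%R.
Proof.
move=> r; elim/frac_ind=> u a; elim/frac_ind=> v b.
rewrite fracD !loc_scaleE fracD scalerDr !scalerA.
by rewrite [r * g ^+ a]mulrC [r * g ^+ b]mulrC.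
Qed.

Fact loc_scaleDl x : {morph loc_scale^~ x : r t / r + t}.
Proof.
by elim/frac_ind: x => u a r t; rewrite !loc_scaleE scalerDl fracDl.
Qed.

HB.instance Definition _ := GRing.Zmodule_isLmodule.Build R loc
  loc_scaleA loc_scale1 loc_scaleDr loc_scaleDl.

Lemma fracZ r u a : r *: frac u a = frac (r *: u) a.
Proof. exact: loc_scaleE. Qed.

End Localization.

Arguments loc {R} M g.
Arguments frac {R M} g u a.

(* The natural map M_g -> M_g', meaningful when g' = g * h: u / g ^ a is sent
   to (h ^ a u) / g' ^ a. *)
Definition loc_map (R : comNzRingType) (M : lmodType R) (g h g' : R)
    (x : loc M g) : loc M g' :=
  let: (u, a) := repr x in frac g' (h ^+ a *: u) a.

Lemma loc_mapE (R : comNzRingType) (M : lmodType R) (g h : R) (u : M) a :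
  loc_map h (g * h) (frac g u a) = frac (g * h) (h ^+ a *: u) a.
Proof.
rewrite /loc_map; have [c] := frac_repr g u a.
case: (repr (frac g u a)) => u' a' /= e.
apply/fracP; exists c; rewrite !exprMn !scalerA -!mulrA -!exprD.
rewrite ![g ^+ _ * _]mulrC -!scalerA e.
by congr (h ^+ _ *: _); lia.
Qed.

(* The Cech complex of M on a sequence g, with
     C^j = \prod_(#|sigma| = j) M_(\prod_(l in sigma) g l).
   A cochain is a family over all sigma; in degree j only the components with
   #|sigma| = j are relevant. *)
Section Cech.
Variables (R : comNzRingType) (M : lmodType R) (r : nat) (g : 'I_r -> R).
Implicit Types sigma tau : {set 'I_r}.

Definition cech_loc sigma := loc M (\prod_(l in sigma) g l).

Definition cech_d (c : forall sigma, cech_loc sigma) tau : cech_loc tau :=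
  \sum_(l in tau) (-1) ^+ #|[set l' in tau | (l' < l)%N]|
     *: loc_map (g l) (\prod_(l' in tau) g l') (c (tau :\ l)).

(* M is graded by D, Mdeg p being its component of degree p, and g l is
   homogeneous of degree e l. *)
Variables (D : zmodType) (Mdeg : D -> M -> Prop) (e : 'I_r -> D).

Definition cech_deg (p : D) sigma (x : cech_loc sigma) : Prop :=
  exists u a, Mdeg (p + (\sum_(l in sigma) e l) *+ a) u /\ x = frac _ u a.

(* H^j of the complex vanishes in degree p. *)
Definition cech_vanishes (j : nat) (p : D) : Prop :=
  forall c : forall sigma, cech_loc sigma,
    (forall sigma, #|sigma| = j -> cech_deg p (c sigma)) ->
    (forall tau, #|tau| = j.+1 -> cech_d c tau = 0) ->
  exists b : forall sigma, cech_loc sigma,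
    (forall sigma, #|sigma|.+1 = j -> cech_deg p (b sigma)) /\
    (forall sigma, #|sigma| = j -> c sigma = cech_d b sigma).

End Cech.

Arguments cech_vanishes {R M r} g {D} Mdeg e j p.

Section Ideals.
Variable R : comNzRingType.

Definition ideal_gen_pred (S : R -> Prop) : {pred R^o} := fun f =>
  `[< exists t : seq (R * R),
        (forall x, x \in t -> S x.2) /\ f = \sum_(x <- t) x.1 * x.2 >].

Fact ideal_gen_closed S : submod_closed (ideal_gen_pred S).
Proof.
split=> [|a u v /asboolP[t [tS ->]] /asboolP[t' [t'S ->]]].
  by apply/asboolP; exists [::]; rewrite big_nil.
apply/asboolP; exists ([seq (a * x.1, x.2) | x <- t] ++ t'); split=> [x|].
  rewrite mem_cat => /orP[/mapP[y yt ->]|]; [exact: (tS y) | exact: t'S].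
rewrite big_cat big_map /=; congr (_ + _); rewrite /GRing.scale /= mulr_sumr.
by apply: eq_bigr => x _; rewrite mulrA.
Qed.

Definition ideal_gen S : submodule R^o := Submodule (ideal_gen_closed S).

Lemma mem_ideal_gen (S : R -> Prop) h : S h -> h \in ideal_gen S.
Proof.
move=> Sh; apply/asboolP; exists [:: (1, h)]; split=> [x|].
  by rewrite inE => /eqP->.
by rewrite big_seq1 mul1r.
Qed.

Lemma ideal_gen_sub (S : R -> Prop) (I : submodule R^o) :
  (forall h, S h -> h \in I) -> {subset ideal_gen S <= I}.
Proof.
move=> SI f /asboolP[t [tS ->]]; rewrite big_seq.
by apply: rpred_sum => x xt; apply: rpredZ; apply: SI; apply: tS.
Qed.

Definition ideal_pow (I : submodule R^o) (n : nat) : submodule R^o :=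
  ideal_gen (fun f =>
    exists h : 'I_n -> R, (forall l, h l \in I) /\ f = \prod_(l < n) h l).

Definition ideal_cap_pred (s : nat) (I : 'I_s -> submodule R^o) : {pred R^o} :=
  fun f => [forall l, f \in I l].

Fact ideal_cap_closed s (I : 'I_s -> submodule R^o) :
  submod_closed (ideal_cap_pred I).
Proof.
split=> [|a u v /forallP uI /forallP vI]; apply/forallP => l.
  exact: rpred0.
by apply: rpredD; [apply: rpredZ; apply: uI | apply: vI].
Qed.

Definition ideal_cap s (I : 'I_s -> submodule R^o) : submodule R^o :=
  Submodule (ideal_cap_closed I).

End Ideals.

(* The homogeneous coordinate ring of P^1 x P^1: the variables of index
   [lshift 2 i] are the x_i, those of index [rshift 2 j] are the y_j. *)
Notation coord_ring k := {mpoly k[2 + 2]}.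

Section Biprojective.
Variable k : closedFieldType.
Local Notation R := (coord_ring k).

Definition xvar (i : 'I_2) : R := 'X_(lshift 2 i).
Definition yvar (j : 'I_2) : R := 'X_(rshift 2 j).

Definition mbideg (m : 'X_{1..2 + 2}) : int * int :=
  ((\sum_(i < 2) m (lshift 2 i))%N%:Z, (\sum_(j < 2) m (rshift 2 j))%N%:Z).

Definition bihomog (p : int * int) (f : R^o) : Prop :=
  forall m, m \in msupp f -> mbideg m = p.

Definition quot_bihomog (I : submodule R^o) (p : int * int)
    (x : {ideal_quot I}) : Prop :=
  exists f, bihomog p f /\ x = \pi_{ideal_quot I} f.

(* [U] has dimension d over k: d of its elements form a basis. *)
Definition has_dim (M : lmodType R) (U : M -> Prop) (d : nat) : Prop :=
  exists b : 'I_d -> M, (forall l, U (b l)) /\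
    forall v, U v ->
      exists! c : {ffun 'I_d -> k}, v = \sum_(l < d) (c l)%:MP *: b l.

Definition irrelevant_ideal : {pred R} := fun f =>
  (f \in ideal_gen (fun h => exists i, h = xvar i)) &&
  (f \in ideal_gen (fun h => exists j, h = yvar j)).

Definition irrelevant_gen (l : 'I_4) : R :=
  tnth [tuple xvar 0 * yvar 0; xvar 0 * yvar 1;
              xvar 1 * yvar 0; xvar 1 * yvar 1] l.

Lemma msupp_ideal_vars (phi : 'I_2 -> 'I_(2 + 2)) (f : R) m :
    f \in ideal_gen (fun h : R => exists i, h = 'X_(phi i)) ->
  m \in msupp f -> exists i, m (phi i) != 0%N.
Proof.
move=> /asboolP[t [tS ->]] mf.
have /flattenP[q /mapP[x]] := msupp_sum_le mf.
rewrite mem_filter => /andP[_ xt] ->; have [i ->] := tS x xt.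
rewrite (perm_mem (msuppMX _ _)) => /mapP[m' _ ->]; exists i.
by rewrite mnmDE mnm1E eqxx.
Qed.

Lemma irrelevant_idealE (f : R) :
  (f \in irrelevant_ideal) =
  (f \in ideal_gen (fun h => exists l, h = irrelevant_gen l)).
Proof.
have gen i j : exists l, xvar i * yvar j = irrelevant_gen l.
  case: i => [[|[|//]] lti]; case: j => [[|[|//]] ltj];
    [exists (inord 0) | exists (inord 1) | exists (inord 2) | exists (inord 3)];
    rewrite /irrelevant_gen (tnth_nth 0) inordK //=;
    by congr (_ _ * _ _); apply: val_inj.
have genP l : exists i j, irrelevant_gen l = xvar i * yvar j.
  rewrite /irrelevant_gen (tnth_nth 0).
  by case: l => [[|[|[|[|//]]]] ?] /=; do 2 eexists.
apply/andP/idP => [[fx fy]|fB]; last first.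
  split; apply: ideal_gen_sub fB => h [l ->]; have [i [j ->]] := genP l.
    rewrite mulrC; apply: (@rpredZ _ R^o); apply: mem_ideal_gen; by exists i.
  by apply: (@rpredZ _ R^o); apply: mem_ideal_gen; exists j.
rewrite [f]mpolyE big_seq; apply: rpred_sum => m mf.
have [i mi] := msupp_ideal_vars (phi := lshift 2) fx mf.
have [j mj] := msupp_ideal_vars (phi := @rshift 2 2) fy mf.
have le_m : (U_(lshift 2 i) + U_(rshift 2 j) <= m)%MM.
  apply/mnm_lepP => l; rewrite mnmDE !mnm1E.
  case: eqVneq => [<-|_]; first by rewrite eq_rlshift addn0 lt0n.
  by case: eqVneq => [<-|_] //; rewrite lt0n.
rewrite -(submK le_m) mpolyXD mpolyXD -mul_mpolyC mulrA.
apply: (@rpredZ _ R^o); apply: mem_ideal_gen; exact: gen.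
Qed.

(* H^j_B(M)_p = 0, computed by the Cech complex on the generators x_i y_j of B
   (see [irrelevant_idealE]), all of degree (1, 1). *)
Definition lc_vanishes (M : lmodType R) (Mdeg : int * int -> M -> Prop) :
    nat -> int * int -> Prop :=
  cech_vanishes irrelevant_gen Mdeg (fun=> (1, 1)).

(* N^2[i]. *)
Definition shifted_quadrant (i : int) (v : int * int) : Prop :=
  exists q : nat * nat, (q.1 + q.2 = `|i|)%N /\
    sgz i * q.1%:Z <= v.1 /\ sgz i * q.2%:Z <= v.2.

Definition regular (M : lmodType R) (Mdeg : int * int -> M -> Prop)
    (m : int * int) : Prop :=
  forall (i : nat) (p : int * int),
    shifted_quadrant (1 - i%:Z) (p - m) -> lc_vanishes Mdeg i p.

(* The points of P^1 are the lines of k^2. *)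
Definition P1 := {V : {vspace 'rV[k]_2} | \dim V == 1%N}.

Definition point_ideal (P : P1 * P1) : submodule R^o :=
  ideal_gen (fun f => (exists p, bihomog p f) /\
    forall u v : 'rV[k]_2, u \in val P.1 -> v \in val P.2 ->
      f.@[fun l => row_mx u v 0 l] = 0).

Definition fat_ideal s (m : 'I_s -> nat) (P : 'I_s -> P1 * P1) :
    submodule R^o :=
  ideal_cap (fun l => ideal_pow (point_ideal (P l)) (m l)).

Definition generic_position s (P : 'I_s -> P1 * P1) : Prop :=
  forall i j : nat, exists d,
    has_dim (M := R^o) (bihomog (i%:Z, j%:Z)) d /\
    has_dim (quot_bihomog (I := ideal_cap (fun l => point_ideal (P l)))
               (i%:Z, j%:Z)) (minn d s).

Definition regB s (m : 'I_s -> nat) (P : 'I_s -> P1 * P1) :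
    int * int -> Prop :=
  regular (quot_bihomog (I := fat_ideal m P)).

End Biprojective.

(* Main.v *)
Require Import Defs.
From mathcomp Require Import all_boot all_order all_algebra mpoly.
From mathcomp Require Import generic_quotient ring_quotient boolp zify ring.
Import Defs.

(** Why the theorem holds. Write [M = R / I_Z], and let [I_Q] be the ideal of a
point [Q] of the support, [m_Q] its multiplicity.

The scheme [Z] is finite, so its local cohomology is governed by one question:
in which bidegrees can the jets of a form at all the points be prescribed at
once? Say that interpolation holds in bidegree [q] if, for all forms [h_Q] not
vanishing at [Q] and [u_Q] of degree [q + deg h_Q], some form [f] of degree [q]
satisfies [h_Q f = u_Q] modulo [I_Q ^ m_Q] for every [Q]; that is, [f] has the
prescribed germ [u_Q / h_Q] at each [Q].

Interpolation makes the Cech complex exact ([cech_vanishing]). A Cech cochain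
on the generators [g_l = x_i y_j] is a family of fractions [u_sigma / g_sigma ^
a], and such a fraction vanishes as soon as its germs do at all the points [Q]
where [g_sigma] does not ([frac_mod_eq0]). At a single point [Q] the complex is
that of a full simplex, on the indices [l] with [g_l(Q) != 0], and the cone
over one vertex [t_Q] contracts it. The contraction prescribes the germs of the
cochain to be found; interpolation, in degree [p + a |sigma| (1, 1)], glues
them. In cohomological degree at least 2 the sets [sigma] that occur are
nonempty, and a large [a] makes this degree as large as desired, so that the
cohomology vanishes for every [p]; in degree 0 nothing has to be glued. Only in
degree 1 is [sigma] empty, and there regularity asks for [p >= (i, j)].

Interpolation in every bidegree [(i, j)] of the theorem is obtained from the
rulings ([interpolation]). Generic position forces distinct points to have
distinct coordinates on both factors: otherwise, forms of degree [(s - 1, 0)]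
or [(0, s - 1)] could not separate two of the points, while they impose [s]
independent conditions ([generic_coord_inj]). Hence the two lines of the
rulings through [Q] miss all other points. Let [V_x], [V_y] be the equations of
the lines through [P]. To correct the term [V_x ^ a V_y ^ b] of a jet at [P],
where [a + b < m_P], one multiplies it by a form of degree [(i - a, j - b)]
which is nonzero at [P] and vanishes to order [m_Q] at each other point [Q]. A
product of [m_Q] lines through each such [Q] does it, and the lines may be
taken from either ruling at will, so that it only remains to fit [\sum_(Q != P)
m_Q] lines in degree [(i - a, j - b)]: possible because [a <= i], [b <= j] and
[\sum_Q m_Q - 1 <= i + j] ([avoiding_form]).

Both halves rest on [I_Q ^ n] being primary. This is read off the Rees algebra:
substituting [b + T (x - b)] for [x], where [b] is the projection of [x] to the
line of vectors that represents the point, turns [I_Q ^ n] into the set of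
polynomials whose image is divisible by [T ^ n] ([mem_ideal_powP]), and [T] is
prime. *)

Set Implicit Arguments.
Unset Strict Implicit.
Unset Printing Implicit Defensive.

#[local] Arguments submodule_pred : simpl never.

(** * Powers of an ideal *)

Section IdealPowers.
Import GRing.Theory.
Local Open Scope ring_scope.
Variable R : comNzRingType.
Implicit Types I : submodule R^o.

Lemma mem_idealM I (a f : R) : f \in I -> a * f \in I.
Proof. exact: (@rpredZ _ R^o). Qed.

Lemma ideal_pow0 I (f : R) : f \in ideal_pow I 0.
Proof.
rewrite -[f]mulr1; apply/mem_idealM/mem_ideal_gen.
by exists (fun=> 0); split=> [[]|]; rewrite ?big_ord0.
Qed.

Lemma ideal_powS I n (f g : R) :
  f \in I -> g \in ideal_pow I n -> f * g \in ideal_pow I n.+1.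
Proof.
move=> fI /asboolP[ts [tsP ->]]; rewrite mulr_sumr big_seq.
apply: rpred_sum => x /tsP[h [hI ->]]; rewrite mulrCA.
apply/mem_idealM/mem_ideal_gen.
exists (fun l => if unlift ord0 l is Some l' then h l' else f).
split=> [l|]; first by case: unliftP.
by rewrite big_ord_recl unlift_none; congr (_ * _); apply: eq_bigr => l _;
   rewrite liftK.
Qed.

Lemma ideal_powX I (f : R) n g d :
  f \in I -> g \in ideal_pow I n -> f ^+ d * g \in ideal_pow I (d + n).
Proof.
move=> fI gI; elim: d => [|d IH]; first by rewrite mul1r.
by rewrite exprS -mulrA addSn; apply: ideal_powS.
Qed.

Lemma ideal_pow_decr I n d (f : R) :
  (d <= n)%N -> f \in ideal_pow I n -> f \in ideal_pow I d.
Proof.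
move=> /subnK <-; elim: (n - d)%N => // {}n IH fI; apply: IH; move: fI.
rewrite addSn; apply: ideal_gen_sub => x [h [hI ->]].
rewrite big_ord_recl; apply/mem_idealM/mem_ideal_gen.
by exists (fun l => h (lift ord0 l)).
Qed.

End IdealPowers.

(** * Polynomials *)

Section Multinomials.
Import GRing.Theory.
Local Open Scope ring_scope.

Lemma mnm_unit_ind n (Pr : 'X_{1..n} -> Prop) :
  Pr 0%MM -> (forall l m, Pr m -> Pr (U_(l) + m)%MM) -> forall m, Pr m.
Proof.
move=> P0 PS m; have [d] := ubnP (mdeg m); elim: d m => // d IH m md.
have [->//|mN0] := eqVneq m 0%MM.
have [l ml] : exists l, m l != 0%N.
  apply/existsP; apply: contra_neqT mN0 => /existsPn m0.
  by apply/mnmP => l; rewrite mnm0E; apply/eqP; rewrite -[_ == _]negbK.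
have le : (U_(l) <= m)%MM.
  by apply/mnm_lepP => l'; rewrite mnm1E; case: eqP => // <-; rewrite lt0n.
rewrite -(submK le) addmC; apply/PS/IH.
by rewrite -(submK le) mdegD mdeg1 addn1 ltnS in md.
Qed.

Lemma rmorph_mmap n (k S S' : comNzRingType) (phi : {rmorphism S -> S'})
    (h : k -> S) (v : 'I_n -> S) (f : {mpoly k[n]}) :
  phi (mmap h v f) = mmap (phi \o h) (phi \o v) f.
Proof.
rewrite /mmap rmorph_sum; apply: eq_bigr => m _.
rewrite rmorphM /mmap1 rmorph_prod; congr (_ * _).
by apply: eq_bigr => l _; rewrite rmorphXn.
Qed.

Lemma mmap_mpolyX n (k : comNzRingType) (f : {mpoly k[n]}) :
  mmap (@mpolyC n k) (fun l => 'X_l) f = f.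
Proof.
rewrite [RHS]mpolyE; apply: eq_bigr => m _.
by rewrite mul_mpolyC mpolyXE_id.
Qed.

(** The variable is prime: it divides [p * q] to order [n] and does not divide
[p], so it divides [q] to order [n]. *)
Lemma low_coef_mull (R : idomainType) (p q : {poly R}) n :
  p`_0 != 0 -> (forall j, (j < n)%N -> (p * q)`_j = 0) ->
  forall j, (j < n)%N -> q`_j = 0.
Proof.
move=> p0 pq j; elim/ltn_ind: j => j IH jn.
have := pq j jn; rewrite coefM big_ord_recl subn0 big1 ?addr0 => [|i _].
  by move/eqP; rewrite mulf_eq0 (negbTE p0) => /eqP.
by rewrite IH ?mulr0 // lift0; have := ltn_ord i; lia.
Qed.

End Multinomials.

(** * Bihomogeneous forms *)

Section Bihomogeneous.
Import GRing.Theory.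
Local Open Scope ring_scope.
Variable k : closedFieldType.
Local Notation R := {mpoly k[2 + 2]}.
Implicit Types (f g : R) (p q : int * int).

Lemma bihomogP p f :
  bihomog p f <-> forall m, mbideg m != p -> f@_m = 0.
Proof.
split=> h m; last by rewrite mcoeff_msupp; apply: contraNeq => /h->.
by apply: contra_neq_eq; rewrite -mcoeff_msupp; apply: h.
Qed.

Lemma bihomog0 p : bihomog p (0 : R).
Proof. by apply/bihomogP => m _; rewrite mcoeff0. Qed.

Lemma bihomogD p f g : bihomog p f -> bihomog p g -> bihomog p (f + g).
Proof.
by move=> /bihomogP fp /bihomogP gp; apply/bihomogP => m mp;
   rewrite mcoeffD fp ?gp ?addr0.
Qed.

Lemma bihomogZ p c f : bihomog p f -> bihomog p (c *: f).
Proof.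
by move=> /bihomogP fp; apply/bihomogP => m mp; rewrite mcoeffZ fp ?mulr0.
Qed.

Lemma bihomogB p f g : bihomog p f -> bihomog p g -> bihomog p (f - g).
Proof. by rewrite -scaleN1r => fp /(bihomogZ (c := -1)); apply: bihomogD. Qed.

Lemma bihomog_sum p (I : Type) (r : seq I) (Q : pred I) (F : I -> R) :
  (forall i, Q i -> bihomog p (F i)) -> bihomog p (\sum_(i <- r | Q i) F i).
Proof.
move=> Fp; elim/big_ind: _ => //; [exact: bihomog0|].
by move=> ? ?; exact: bihomogD.
Qed.

Lemma mbidegD m m' : mbideg (m + m')%MM = mbideg m + mbideg m'.
Proof.
by congr pair; rewrite -PoszD -big_split; congr Posz;
  apply: eq_bigr => i _; rewrite mnmDE.
Qed.

Lemma bihomogM p q f g : bihomog p f -> bihomog q g -> bihomog (p + q) (f * g).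
Proof.
move=> fp gq m /msuppM_le/allpairsP[[m1 m2] /= [/fp <- /gq <- ->]].
exact: mbidegD.
Qed.

Lemma bihomog1 : bihomog 0 (1 : R).
Proof.
move=> m; rewrite msupp1 inE => /eqP->.
by rewrite /mbideg !big1 // => i _; rewrite mnm0E.
Qed.

Lemma bihomogX p f n : bihomog p f -> bihomog (p *+ n) (f ^+ n).
Proof.
move=> fp; elim: n => [|n IH]; first exact: bihomog1.
by rewrite mulrS exprS; apply: bihomogM.
Qed.

Lemma mbideg_lshift i : mbideg U_(lshift 2 i) = (1, 0).
Proof.
rewrite /mbideg (bigD1 i) //= mnm1E eqxx !big1 // => j ji; rewrite mnm1E.
  by rewrite eq_lrshift.
by rewrite eq_lshift eq_sym (negbTE ji).
Qed.

Lemma mbideg_rshift i : mbideg U_(rshift 2 i) = (0, 1).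
Proof.
rewrite /mbideg [in X in (_, X)](bigD1 i) //= mnm1E eqxx !big1 // => j ji;
  rewrite mnm1E.
  by rewrite eq_rshift eq_sym (negbTE ji).
by rewrite eq_rlshift.
Qed.

Lemma bihomog_xvar i : bihomog (1, 0) (xvar k i).
Proof. by move=> m; rewrite msuppX inE => /eqP->; exact: mbideg_lshift. Qed.

Lemma bihomog_yvar i : bihomog (0, 1) (yvar k i).
Proof. by move=> m; rewrite msuppX inE => /eqP->; exact: mbideg_rshift. Qed.

(** The family on the four variables that is constant on the [x_i] and on the
[y_j]. *)
Definition blocks (S : Type) (c d : S) (l : 'I_(2 + 2)) : S :=
  if split l is inl _ then c else d.

Lemma prod_blocks (S : comNzRingType) (c d : S) (m : 'X_{1..2 + 2})
    (p q : nat) :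
  mbideg m = (p%:Z, q%:Z) -> \prod_l blocks c d l ^+ m l = c ^+ p * d ^+ q.
Proof.
case=> <- <-; rewrite big_split_ord /= -!prodrXr.
by congr (_ * _); [apply: eq_bigr|apply: eq_bigr] => i _;
  rewrite /blocks ?(unsplitK (inl _)) ?(unsplitK (inr _)).
Qed.

(** Bihomogeneity as Euler scaling.  It is used in [k], to compare the
representatives of a point, and in the coordinate ring, to substitute multiples
of a representative by linear forms. *)
Lemma mmap_scale (S : comNzRingType) (h : {rmorphism k -> S}) (c d : S)
    (w : 'I_(2 + 2) -> k) (p q : nat) f :
    bihomog (p%:Z, q%:Z) f ->
  mmap h (fun l => blocks c d l * h (w l)) f = c ^+ p * d ^+ q * h f.@[w].
Proof.
move=> fpq; rewrite /meval rmorph_mmap mulr_sumr /mmap big_seq [RHS]big_seq.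
apply: eq_bigr => m /fpq mpq; rewrite mulrCA; congr (_ * _).
rewrite -(prod_blocks _ _ mpq) -big_split; apply: eq_bigr => l _.
by rewrite exprMn.
Qed.

Lemma bihomog_nat p f : f != 0 -> bihomog p f ->
  exists a b : nat, p = (a%:Z, b%:Z).
Proof.
by rewrite -msupp_eq0; case E: (msupp f) => [//|m r] _ /(_ m);
  rewrite E mem_head => /(_ isT) <-; do 2 eexists.
Qed.

End Bihomogeneous.

(** * Exactness of the Cech complex by interpolation *)

Section Cech.
Import GRing.Theory.
Local Open Scope ring_scope.
Local Open Scope quotient_scope.

Lemma pi_eq0 (R : comNzRingType) (M : lmodType R) (N : submodule M) (u : M) :
  (\pi_{ideal_quot N} u == 0) = (u \in N).
Proof.
by rewrite -[u in RHS]subr0 Quotient.idealrBE -(raddf0 (\pi_{ideal_quot N})).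
Qed.

Section Localization.
Variables (R : comNzRingType) (M : lmodType R).

Lemma frac_eq0 (g : R) (u : M) a :
  frac g u a = 0 <-> exists c, g ^+ c *: u = 0.
Proof.
rewrite -(frac0 _ _ 0) fracP; split=> -[c]; rewrite ?addn0 ?scaler0 => e.
  by exists c.
by exists c; rewrite addn0 e scaler0.
Qed.

Lemma frac_sum (g : R) (I : Type) (r : seq I) (Q : pred I) (u : I -> M) a :
  frac g (\sum_(i <- r | Q i) u i) a = \sum_(i <- r | Q i) frac g (u i) a.
Proof.
by apply: (big_morph (fun u => frac g u a)) => [x y|]; rewrite ?fracDl ?frac0.
Qed.

Lemma fracB (g : R) (u v : M) a : frac g (u - v) a = frac g u a - frac g v a.
Proof. by rewrite fracDl -[- v]scaleN1r -fracZ scaleN1r. Qed.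

Lemma loc_map_frac (g h g' : R) (u : M) a :
  g' = g * h -> loc_map h g' (frac g u a) = frac g' (h ^+ a *: u) a.
Proof. by move=> ->; exact: loc_mapE. Qed.

End Localization.

(** The exponent of the sign attached to [l] in the Cech differential. *)
Definition position r (tau : {set 'I_r}) (l : 'I_r) : nat :=
  #|[set l' in tau | (l' < l)%N]|.

Lemma position_setU1 r (tau : {set 'I_r}) (l t : 'I_r) :
  t \notin tau -> position (t |: tau) l = ((t < l) + position tau l)%N.
Proof.
move=> tNtau; rewrite /position; have [tl|lt] := boolP (t < l)%N.
  transitivity #|t |: [set l' in tau | (l' < l)%N]|; last first.
    by rewrite cardsU1 inE (negbTE tNtau).
  by apply: eq_card => l'; rewrite !inE; case: eqP => // ->; rewrite tl.
rewrite add0n; apply: eq_card => l'; rewrite !inE.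
by case: eqP => [->|_] //; rewrite (negbTE lt) !andbF.
Qed.

(** The signs that make the cone over the vertex [t] a contracting homotopy:
exactly one of [l] and [t] precedes the other. *)
Lemma position_sign (A : pzRingType) r (tau : {set 'I_r}) (l t : 'I_r) :
    t \notin tau -> l \in tau ->
  (-1) ^+ position (t |: tau) t * (-1) ^+ position (t |: tau) l =
  - ((-1) ^+ position tau l * (-1) ^+ position (tau :\ l) t) :> A.
Proof.
move=> tNtau ltau; have lt : l != t by apply: contraNneq tNtau => <-.
rewrite !position_setU1 // ltnn add0n.
rewrite -[in X in (-1) ^+ X * _](setD1K ltau).
rewrite position_setU1 ?setD11 //.
rewrite -!exprD -[in RHS]mulN1r -exprS -signr_odd -[RHS]signr_odd.
congr (_ ^+ (nat_of_bool _)); rewrite /= !oddD !oddb.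
have [||/val_inj e] := ltngtP l t; last by rewrite e eqxx in lt.
  by do 2!case: odd.
by do 2!case: odd.
Qed.

(** In the application [J Q] is the ideal [I_Q ^ m_Q] of a fat point, and [g l]
is a nonzerodivisor modulo [J Q] if it does not vanish at [Q], nilpotent
otherwise; [t Q] is an index of the first kind. *)
Section Vanishing.
Variables (R : comNzRingType) (r s : nat) (g : 'I_r -> R).
Variables (J : 'I_s -> submodule R^o) (t : 'I_s -> 'I_r).
Variables (D : zmodType) (Rdeg : D -> R^o -> Prop) (e : 'I_r -> D).
Let M := {ideal_quot (ideal_cap J)}.
Let Mdeg (p : D) (x : M) : Prop :=
  exists f, Rdeg p f /\ x = \pi_{ideal_quot (ideal_cap J)} f.
Let gs (sigma : {set 'I_r}) : R := \prod_(l in sigma) g l.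
Let es (sigma : {set 'I_r}) : D := \sum_(l in sigma) e l.

Hypothesis Rdeg0 : forall q, Rdeg q 0.
Hypothesis RdegZ : forall q (n : nat) f, Rdeg q f -> Rdeg q ((-1) ^+ n * f).
Hypothesis RdegM : forall q l f, Rdeg q f -> Rdeg (q + e l) (g l * f).

Definition nonzerodivisor (Q : 'I_s) (h : R) :=
  forall f, h * f \in J Q -> f \in J Q.

Hypothesis g_dichotomy :
  forall Q l, nonzerodivisor Q (g l) \/ exists n, g l ^+ n \in J Q.
Hypothesis t_regular : forall Q, nonzerodivisor Q (g (t Q)).

Lemma RdegX q l n f : Rdeg q f -> Rdeg (q + e l *+ n) (g l ^+ n * f).
Proof.
elim: n => [|n IH] qf; first by rewrite mulr0n addr0 expr0 mul1r.
by rewrite mulrSr addrA exprS -mulrA; apply/RdegM/IH.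
Qed.

Lemma RdegXs q (sigma : {set 'I_r}) n f :
  Rdeg q f -> Rdeg (q + es sigma *+ n) (gs sigma ^+ n * f).
Proof.
move=> qf; rewrite /gs /es -prodrXl -sumrMnl.
elim/big_rec2: _ q f qf => [|l x y _ IH] q f qf.
  by rewrite addr0 mul1r.
by rewrite [e l *+ n + _]addrC addrA -mulrA; apply/RdegX/IH.
Qed.

Lemma nonzerodivisorX Q h n : nonzerodivisor Q h -> nonzerodivisor Q (h ^+ n).
Proof.
move=> hreg; elim: n => [|n IH] f; first by rewrite mul1r.
by rewrite exprS -mulrA => /hreg/IH.
Qed.

Lemma nonzerodivisor_prod Q (sigma : {set 'I_r}) :
  (forall l, l \in sigma -> nonzerodivisor Q (g l)) ->
  nonzerodivisor Q (gs sigma).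
Proof.
rewrite /gs => sreg; elim/big_ind: _ => [f|h h' hreg h'reg f|l /sreg//].
  by rewrite mul1r.
by rewrite -mulrA => /hreg/h'reg.
Qed.

(** A fraction vanishes if and only if its germs do at the points off the zero
locus of the denominator: at the other points, a power of the denominator lies
in the ideal. *)
Lemma frac_mod_eq0 (sigma : {set 'I_r}) (u : R) a :
  frac (gs sigma) (\pi_M u : M) a = 0 <->
  forall Q, (forall l, l \in sigma -> nonzerodivisor Q (g l)) -> u \in J Q.
Proof.
have piZ (x y : R) : x *: (\pi_M y : M) = \pi_M (x * y) by exact: quot_scaleE.
rewrite frac_eq0; split=> [[c] /eqP|uJ].
  rewrite piZ pi_eq0 => /forallP cuJ Q sreg.
  by apply: (nonzerodivisorX (n := c) (nonzerodivisor_prod sreg)); exact: cuJ.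
have nilp Q l : exists n, nonzerodivisor Q (g l) \/ g l ^+ n \in J Q.
  by case: (g_dichotomy Q l) => [|[n]]; [exists 0%N; left | exists n; right].
pose N Q l := projT1 (cid (nilp Q l)).
(* A bound for all the exponents of nilpotency. *)
exists (\sum_Q \sum_l N Q l)%N; apply/eqP; rewrite piZ pi_eq0.
apply/forallP => Q.
have [sreg|/existsNP[l /not_implyP[lsigma lNreg]]] :=
    pselect (forall l, l \in sigma -> nonzerodivisor Q (g l)).
  by apply: mem_idealM; apply: uJ.
have [//|gJ] := projT2 (cid (nilp Q l)).
have le : (N Q l <= \sum_Q \sum_l N Q l)%N.
  by rewrite (bigD1 Q) //= (bigD1 l) //= -addnA leq_addr.
rewrite -(subnK le) exprD -mulrA; apply: mem_idealM.
by rewrite /gs (bigD1 l) //= exprMn -mulrA mulrC; apply: mem_idealM.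
Qed.

Lemma cech_dE (u : {set 'I_r} -> R) a tau :
  cech_d (fun sigma => frac (gs sigma) (\pi_M (u sigma) : M) a) tau =
  frac (gs tau)
    (\pi_M (\sum_(l in tau) (-1) ^+ position tau l
       * (g l ^+ a * u (tau :\ l))) : M) a.
Proof.
have piZ (x y : R) : x *: (\pi_M y : M) = \pi_M (x * y) by exact: quot_scaleE.
rewrite raddf_sum frac_sum; apply: eq_bigr => l ltau.
have gsE : gs tau = gs (tau :\ l) * g l by rewrite mulrC -big_setD1.
rewrite (loc_map_frac (g := gs (tau :\ l)) _ _ gsE).
by rewrite (piZ (g l ^+ a) (u (tau :\ l))) fracZ piZ.
Qed.

(** At each [Q] the complex is contracted by the cone over the vertex [t Q], so
the germ of the primitive on [sigma] is the one of the cocycle on [t Q |: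
sigma], up to sign, or 0 if [sigma] contains [t Q]. The hypothesis produces
fractions of degree [p] with these germs. *)
Lemma cech_vanishing j p :
    (exists a0, forall a (sigma : {set 'I_r}), (a0 <= a)%N -> #|sigma|.+1 = j ->
       forall u : 'I_s -> R,
         (forall Q, Rdeg (p + es sigma *+ a + e (t Q) *+ a) (u Q)) ->
       exists2 f, Rdeg (p + es sigma *+ a) f &
         forall Q, g (t Q) ^+ a * f - u Q \in J Q) ->
  cech_vanishes g Mdeg e j p.
Proof.
move=> [a0 interp] c cdeg cocycle.
(* Reduce all the components of the cocycle to the same large exponent [a]. *)
have [a [u [a0a udeg cE]]] : exists a (u : {set 'I_r} -> R), [/\ (a0 <= a)%N,
    forall sigma : {set 'I_r}, #|sigma| = j ->
      Rdeg (p + es sigma *+ a) (u sigma) &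
    forall sigma : {set 'I_r}, #|sigma| = j ->
      c sigma = frac (gs sigma) (\pi_M (u sigma) : M) a].
  have rep (sigma : {set 'I_r}) : exists va : R * nat, #|sigma| = j ->
      Rdeg (p + es sigma *+ va.2) va.1 /\
      c sigma = frac (gs sigma) (\pi_M va.1 : M) va.2.
    have [/cdeg[x [b [[v [vdeg ->]] ->]]]|sNj] := eqVneq #|sigma| j.
      by exists (v, b).
    by exists (0, 0%N) => sj; rewrite sj eqxx in sNj.
  have [va vaP] := choice rep.
  pose a := (a0 + \sum_sigma (va sigma).2)%N.
  have va_le sigma : ((va sigma).2 <= a)%N.
    by rewrite /a (bigD1 sigma) //= addnCA leq_addr.
  exists a, (fun sigma : {set 'I_r} =>
    gs sigma ^+ (a - (va sigma).2) * (va sigma).1).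
  split=> [|sigma sj|sigma sj]; first exact: leq_addr.
    have [vdeg _] := vaP sigma sj.
    rewrite -{1}(subnK (va_le sigma)) addnC mulrnDr addrA.
    exact: RdegXs.
  have [_ ->] := vaP sigma sj.
  by rewrite -[RHS]/(frac _ (\pi_M _) _) -quot_scaleE -{2}(subnK (va_le sigma))
    frac_cancel.
have ucocycle (tau : {set 'I_r}) Q : #|tau| = j.+1 ->
    (forall l, l \in tau -> nonzerodivisor Q (g l)) ->
  \sum_(l in tau) (-1) ^+ position tau l * (g l ^+ a * u (tau :\ l)) \in J Q.
  move=> tauj; move: Q; apply/(frac_mod_eq0 tau _ a).
  rewrite -[RHS](cocycle tau tauj); apply: (etrans (esym (cech_dE u a tau))).
  apply: eq_bigr => l ltau; rewrite cE //.
  by apply/eqP; rewrite -eqSS -tauj (cardsD1 l tau) ltau.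
(* The germs at [Q] of the primitive, up to the denominator
   [(g (t Q) * gs sigma) ^+ a]. *)
pose w Q (sigma : {set 'I_r}) : R := if t Q \in sigma then 0
  else (-1) ^+ position sigma (t Q) * u (t Q |: sigma).
have vex (sigma : {set 'I_r}) : exists f : R, #|sigma|.+1 = j ->
    Rdeg (p + es sigma *+ a) f /\
    forall Q, g (t Q) ^+ a * f - w Q sigma \in J Q.
  have [sj|sNj] := eqVneq #|sigma|.+1 j; last first.
    by exists 0 => sj; rewrite sj eqxx in sNj.
  have [|f fdeg fP] := interp a sigma a0a sj (w^~ sigma); last by exists f.
  move=> Q; rewrite /w; case: ifPn => [_|tNs]; first exact: Rdeg0.
  apply: RdegZ; rewrite -addrA -mulrnDl [es sigma + _]addrC.
  have -> : e (t Q) + es sigma = es (t Q |: sigma) by rewrite /es big_setU1.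
  by apply: udeg; rewrite cardsU1 tNs.
have [v vP] := choice vex.
exists (fun sigma : {set 'I_r} => frac (gs sigma) (\pi_M (v sigma) : M) a).
split=> [sigma sj|tau tauj].
  have [vdeg _] := vP sigma sj.
  by exists (\pi_M (v sigma)), a; split=> //; exists (v sigma).
rewrite cE // cech_dE; apply/eqP; rewrite -subr_eq0 -fracB -raddfB.
apply/eqP/frac_mod_eq0 => Q treg.
apply: (nonzerodivisorX (n := a) (t_regular (Q := Q))).
set gt := g (t Q) ^+ a.
have vw l : l \in tau -> gt * v (tau :\ l) - w Q (tau :\ l) \in J Q.
  by move=> ltau; apply: (vP _ _).2; rewrite -tauj (cardsD1 l tau) ltau.
(* The primitive may be replaced by its prescribed germs. *)
suff main : gt * u tau - \sum_(l in tau) (-1) ^+ position tau l *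
    (g l ^+ a * w Q (tau :\ l)) \in J Q.
  have -> : gt * (u tau - \sum_(l in tau) (-1) ^+ position tau l *
                    (g l ^+ a * v (tau :\ l))) =
      gt * u tau - \sum_(l in tau) (-1) ^+ position tau l *
                     (g l ^+ a * w Q (tau :\ l))
      - \sum_(l in tau) (-1) ^+ position tau l * g l ^+ a *
          (gt * v (tau :\ l) - w Q (tau :\ l)).
    rewrite mulrBr mulr_sumr -addrA -opprD -big_split; congr (_ - _).
    by apply: eq_bigr => l _ /=; ring.
  by apply: rpredB => //; apply: rpred_sum => l ltau; apply/mem_idealM/vw.
have [ttau|tNtau] := boolP (t Q \in tau).
  rewrite (bigD1 (t Q)) //= big1 => [|l /andP[ltau lNt]]; last first.
    by rewrite /w in_setD1 eq_sym lNt ttau !mulr0.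
  have -> : position tau (t Q) = position (tau :\ t Q) (t Q).
    by rewrite -[in LHS](setD1K ttau) position_setU1 ?setD11 // ltnn.
  rewrite /w setD11 setD1K // mulrCA signrMK addr0 subrr.
  exact: rpred0.
(* The cocycle condition on the cone over [tau]. *)
have := ucocycle (t Q |: tau) Q; rewrite cardsU1 tNtau tauj => /(_ erefl).
have treg' l : l \in t Q |: tau -> nonzerodivisor Q (g l).
  by rewrite in_setU1 => /orP[/eqP->|/treg] //; exact: t_regular.
move/(_ treg')/(mem_idealM ((-1) ^+ position (t Q |: tau) (t Q))).
rewrite big_setU1 //= setU1K // mulrDr signrMK mulr_sumr -sumrN.
move=> h; apply: etrans h; apply: (congr1 (fun x => gt * u tau + x \in J Q)).
apply: eq_bigr => l ltau; symmetry.
rewrite mulrA position_sign // /w in_setD1 (negbTE tNtau) andbF.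
have -> : t Q |: tau :\ l = (t Q |: tau) :\ l.
  apply/setP => l'; rewrite !inE; have [->|//] := eqVneq l' (t Q).
  by rewrite andbT /=; symmetry; apply: contraNneq tNtau => ->.
by ring.
Qed.
End Vanishing.
End Cech.

(** * Points and their ideals *)

Section Points.
Import GRing.Theory.
Local Open Scope ring_scope.
Variable k : closedFieldType.
Local Notation R := {mpoly k[2 + 2]}.
Implicit Types (f g h : R) (V : P1 k) (P Q : P1 k * P1 k).

Definition rep V : 'rV[k]_2 := vpick (val V).

(** A nonzero vector of [k^2] has a nonzero coordinate, its pivot.  The linear
forms [unit_form] and [zero_form], with values 1 and 0 at the vector, are then
coordinates on the line. *)
Definition pivot V : 'I_2 := if rep V 0 0 != 0 then 0 else 1.
Definition copivot V : 'I_2 := if rep V 0 0 != 0 then 1 else 0.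

Definition unit_form (X : 'I_2 -> R) V : R :=
  (rep V 0 (pivot V))^-1 *: X (pivot V).
Definition zero_form (X : 'I_2 -> R) V : R :=
  X (copivot V) - rep V 0 (copivot V) *: unit_form X V.

Lemma P1_line V : val V = <[rep V]>%VS.
Proof.
have /eqP dV := valP V; have rV : rep V \in val V by exact: memv_pick.
apply/esym/eqP; rewrite eqEdim -memvE rV dV dim_vline.
by rewrite lt0b vpick0 -dimv_eq0 dV.
Qed.

Lemma rep_neq0 V : rep V != 0.
Proof. by rewrite vpick0 -dimv_eq0 (eqP (valP V)). Qed.

Lemma rep_pivot V : rep V 0 (pivot V) != 0.
Proof.
rewrite /pivot; have [a0|//] := eqVneq (rep V 0 0) 0.
apply: contraNneq (rep_neq0 V) => a1; apply/eqP/rowP => i; rewrite mxE.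
by case: i => [[|[|//]] lti]; [rewrite -a0|rewrite -a1]; congr (rep V 0 _);
  apply: val_inj.
Qed.

Lemma rep_inj V W c : rep W = c *: rep V -> W = V.
Proof.
move=> e; apply/val_inj/eqP; rewrite eqEdim (eqP (valP V)) (eqP (valP W)) andbT.
by rewrite !P1_line -memvE e memvZ ?memv_line.
Qed.

Lemma coord_forms (X : 'I_2 -> R) V i :
  X i = (i != pivot V)%:R *: zero_form X V + rep V 0 i *: unit_form X V.
Proof.
have [->|ip] := eqVneq i (pivot V).
  by rewrite scale0r add0r scalerA divff ?scale1r // rep_pivot.
suff -> : i = copivot V by rewrite scale1r subrK.
move: ip; rewrite /pivot /copivot.
by case: ifP; case: i => [[|[|//]] lti] _ // _; apply: val_inj.
Qed.

Definition pt P (l : 'I_(2 + 2)) : k := row_mx (rep P.1) (rep P.2) 0 l.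
Local Notation ev P f := (f.@[pt P]).

Definition Ux P := unit_form (xvar k) P.1.
Definition Uy P := unit_form (yvar k) P.2.
Definition Vx P := zero_form (xvar k) P.1.
Definition Vy P := zero_form (yvar k) P.2.

Lemma bihomog_Ux P : bihomog (1, 0) (Ux P).
Proof. exact/bihomogZ/bihomog_xvar. Qed.
Lemma bihomog_Uy P : bihomog (0, 1) (Uy P).
Proof. exact/bihomogZ/bihomog_yvar. Qed.
Lemma bihomog_Vx P : bihomog (1, 0) (Vx P).
Proof. exact/bihomogB/bihomogZ/bihomog_Ux/bihomog_xvar. Qed.
Lemma bihomog_Vy P : bihomog (0, 1) (Vy P).
Proof. exact/bihomogB/bihomogZ/bihomog_Uy/bihomog_yvar. Qed.

Lemma ev_xvar P i : ev P (xvar k i) = rep P.1 0 i.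
Proof. by rewrite mevalXU /pt row_mxEl. Qed.
Lemma ev_yvar P i : ev P (yvar k i) = rep P.2 0 i.
Proof. by rewrite mevalXU /pt row_mxEr. Qed.

Lemma ev_Ux P : ev P (Ux P) = 1.
Proof. by rewrite mevalZ ev_xvar mulVf ?rep_pivot. Qed.
Lemma ev_Uy P : ev P (Uy P) = 1.
Proof. by rewrite mevalZ ev_yvar mulVf ?rep_pivot. Qed.
Lemma ev_Vx P : ev P (Vx P) = 0.
Proof. by rewrite mevalB mevalZ ev_xvar ev_Ux mulr1 subrr. Qed.
Lemma ev_Vy P : ev P (Vy P) = 0.
Proof. by rewrite mevalB mevalZ ev_yvar ev_Uy mulr1 subrr. Qed.

(** The line of the ruling through [P] contains only the points with the same
first coordinate: elsewhere on it, [x] would be proportional to [rep P.1]. *)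
Lemma ev_Vx_neq0 P Q : P.1 != Q.1 -> ev Q (Vx P) != 0.
Proof.
apply: contraNneq => V0; apply/eqP/esym.
apply: (@rep_inj _ _ (ev Q (Ux P))); apply/rowP => i.
rewrite mxE -ev_xvar (coord_forms (xvar k) P.1) mevalD !mevalZ.
by rewrite -[zero_form _ _]/(Vx P) V0 mulr0 add0r mulrC.
Qed.

Lemma ev_Vy_neq0 P Q : P.2 != Q.2 -> ev Q (Vy P) != 0.
Proof.
apply: contraNneq => V0; apply/eqP/esym.
apply: (@rep_inj _ _ (ev Q (Uy P))); apply/rowP => i.
rewrite mxE -ev_yvar (coord_forms (yvar k) P.2) mevalD !mevalZ.
by rewrite -[zero_form _ _]/(Vy P) V0 mulr0 add0r mulrC.
Qed.

(** Being homogeneous, a form that vanishes at one representative vanishes at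
all. *)
Lemma mem_point_ideal P p f :
  bihomog p f -> ev P f = 0 -> f \in point_ideal P.
Proof.
move=> fp f0; apply: mem_ideal_gen; split=> [|u v]; first by exists p.
rewrite !P1_line => /vlineP[c ->] /vlineP[d ->].
have [->|fN0] := eqVneq f 0; first by rewrite meval0.
have [a [b pE]] := bihomog_nat fN0 fp; rewrite pE in fp.
have := mmap_scale idfun c d (pt P) fp; rewrite /= f0 mulr0 => <-.
apply: meval_eq => l; rewrite /blocks /pt.
by case: (split_ordP l) => i ->; rewrite /=
  ?row_mxEl ?row_mxEr mxE.
Qed.

Lemma Vx_ideal P : Vx P \in point_ideal P.
Proof. exact: (mem_point_ideal (@bihomog_Vx P) (ev_Vx P)). Qed.
Lemma Vy_ideal P : Vy P \in point_ideal P.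
Proof. exact: (mem_point_ideal (@bihomog_Vy P) (ev_Vy P)). Qed.

Section Rees.
Variable P : P1 k * P1 k.
Local Notation I := (point_ideal P).

(** The coordinates of the projection to the point: on [x] it is
[U_x(x) rep P.1]. *)
Definition base_form l : R := blocks (Ux P) (Uy P) l * (pt P l)%:MP.

(** The degeneration [x := base + T (x - base)], which is the identity at [T =
1] and the projection to the point at [T = 0]. Since [x - base] lies in the
ideal [I] of the point, it takes values in the Rees algebra [\sum_j I ^ j T ^
j]. *)
Definition spread (f : R) : {poly R} :=
  mmap (polyC \o @mpolyC _ k)
    (fun l => ('X_l - base_form l)%:P * 'X + (base_form l)%:P) f.

Lemma spreadM f g : spread (f * g) = spread f * spread g.
Proof. exact: rmorphM. Qed.

Lemma spread_sum (T : Type) (r : seq T) (F : T -> R) :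
  spread (\sum_(x <- r) F x) = \sum_(x <- r) spread (F x).
Proof. exact: rmorph_sum. Qed.

Lemma base_form_cong l : 'X_l - base_form l \in I.
Proof.
rewrite /base_form mulrC mul_mpolyC /blocks /pt.
case: (split_ordP l) => i ->.
  rewrite row_mxEl -[X in X - _]/(xvar k i).
  rewrite [X in X - _](coord_forms (xvar k) P.1 i) addrK -mul_mpolyC.
  exact/mem_idealM/Vx_ideal.
rewrite row_mxEr -[X in X - _]/(yvar k i).
rewrite [X in X - _](coord_forms (yvar k) P.2 i) addrK -mul_mpolyC.
exact/mem_idealM/Vy_ideal.
Qed.

Lemma coef_spread_ideal f j : (spread f)`_j \in ideal_pow I j.
Proof.
rewrite /spread /mmap coef_sum; apply: rpred_sum => m _.
rewrite coefCM; apply: mem_idealM.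
elim/mnm_unit_ind: m j => [|l m IH] j.
  rewrite mmap11 coef1; case: eqP => [->|_]; last exact: rpred0.
  exact: ideal_pow0.
rewrite commr_mmap1_M => [|? ?]; last exact: mulrC.
rewrite mmap1U mulrDl coefD -mulrA !coefCM.
apply: rpredD; last exact: mem_idealM.
rewrite coefXM; case: j => [|j] /=; first exact: ideal_pow0.
by apply: ideal_powS => //; exact: base_form_cong.
Qed.

Lemma horner_spread f c :
  (spread f).[c] =
  mmap (@mpolyC _ k) (fun l => ('X_l - base_form l) * c + base_form l) f.
Proof.
have := rmorph_mmap (horner_eval c) (polyC \o @mpolyC _ k)
  (fun l => ('X_l - base_form l)%:P * 'X + (base_form l)%:P) f.
rewrite -[LHS]/((spread f).[c]) => ->; apply: eq_bigr => m _.
congr (_ * _); first by rewrite /= /horner_eval hornerC.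
by apply: eq_bigr => l _; rewrite /= /horner_eval !hornerE.
Qed.

Lemma spread1 f : (spread f).[1] = f.
Proof.
rewrite horner_spread -[RHS]mmap_mpolyX; apply: eq_bigr => m _; congr (_ * _).
by apply: eq_bigr => l _; rewrite mulr1 subrK.
Qed.

Lemma spread0 f : (spread f)`_0 = mmap (@mpolyC _ k) base_form f.
Proof.
rewrite -horner_coef0 horner_spread; apply: eq_bigr => m _; congr (_ * _).
by apply: eq_bigr => l _; rewrite mulr0 add0r.
Qed.

Lemma ev_spread0 f : ev P ((spread f)`_0) = ev P f.
Proof.
rewrite spread0; have := rmorph_mmap (meval (pt P)) (@mpolyC _ k) base_form f.
move=> ->; apply: eq_bigr => m _; congr (_ * _); first by rewrite /= mevalC.
apply: eq_bigr => l _; congr (_ ^+ _).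
rewrite /= mevalM mevalC /blocks; case: split => _.
  by rewrite ev_Ux mul1r.
by rewrite ev_Uy mul1r.
Qed.

#[local] Opaque spread.

Lemma spread0_ideal f : f \in I -> (spread f)`_0 = 0.
Proof.
move=> /asboolP[t [tP ->]]; rewrite spread_sum coef_sum big_seq big1 // => x.
move=> /tP[[p xp] x0].
suff e : (spread x.2)`_0 = 0 by rewrite spreadM coef0M [X in _ * X]e mulr0.
have [->|xN0] := eqVneq x.2 0; first by rewrite spread0 mmap0.
have [a [b pE]] := bihomog_nat xN0 xp; rewrite pE in xp.
rewrite spread0.
apply: (etrans (mmap_scale (@mpolyC (2 + 2) k) (Ux P) (Uy P) (pt P) xp)).
by rewrite [x.2.@[_]]x0 ?memv_pick // rmorph0 mulr0.
Qed.

Lemma spread_prod_order n (h : 'I_n -> R) j :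
  (forall l, h l \in I) -> (j < n)%N -> (spread (\prod_l h l))`_j = 0.
Proof.
elim: n h j => // n IH h j hI jn.
rewrite big_ord_recl spreadM coefM big_ord_recl.
rewrite [X in X * _ + _](spread0_ideal (hI ord0)) mul0r add0r.
rewrite big1 => [//|i _]; rewrite [X in _ * X]IH ?mulr0 => [//|l|].
  exact: hI.
by rewrite lift0; have := ltn_ord i; lia.
Qed.

(** A polynomial [f] is the sum of the coefficients of [spread f], and the
coefficient of [T ^ j] lies in [I ^ j]; conversely [T] divides [spread f] for
[f] in [I]. *)
Lemma mem_ideal_powP n f :
  f \in ideal_pow I n <-> forall j, (j < n)%N -> (spread f)`_j = 0.
Proof.
split=> [/asboolP[t [tP ->]] j jn|f0].
  rewrite spread_sum coef_sum big_seq big1 // => x /tP[h [hI ->]].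
  rewrite spreadM coefM big1 => [//|i _].
  rewrite [X in _ * X]spread_prod_order ?mulr0 => [//|//|].
  by apply: leq_ltn_trans jn; exact: leq_subr.
rewrite -[f]spread1 horner_coef; apply: rpred_sum => j _.
rewrite expr1n mulr1; have [/f0->|nj] := ltnP j n; first exact: rpred0.
exact/(ideal_pow_decr nj)/coef_spread_ideal.
Qed.

(** The constant term of [spread h] has the same value as [h] at the point, so
[T] does not divide [spread h]. *)
Lemma ideal_pow_primary n h f :
  ev P h != 0 -> h * f \in ideal_pow I n -> f \in ideal_pow I n.
Proof.
move=> hP /mem_ideal_powP hf; apply/mem_ideal_powP.
apply: (low_coef_mull (p := spread h)) => [|j jn].
  by apply: contraNneq hP => h0; rewrite -ev_spread0 h0 meval0.
by rewrite -spreadM; exact: hf.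
Qed.

End Rees.

End Points.

(** * Interpolation at fat points *)

Section Interpolation.
Import GRing.Theory Num.Theory Order.TTheory.
Local Open Scope ring_scope.
Variable k : closedFieldType.
Local Notation R := {mpoly k[2 + 2]}.
Local Notation ev P f := (f.@[pt P]).
Implicit Types (f g h : R) (P Q : P1 k * P1 k).

Lemma pairMn (x y : int) n : (x, y) *+ n = (x *+ n, y *+ n).
Proof. by elim: n => // n IH; rewrite !mulrS IH. Qed.

Lemma bihomog_VM P a b q g :
  bihomog (q - (a%:Z, b%:Z)) g -> bihomog q (Vx P ^+ a * (Vy P ^+ b * g)).
Proof.
move=> gq.
have := bihomogM (bihomogX (n := a) (@bihomog_Vx k P))
  (bihomogM (bihomogX (n := b) (@bihomog_Vy k P)) gq).
rewrite !pairMn; congr bihomog; case: q {gq} => q1 q2.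
by congr pair; rewrite /=; lia.
Qed.

(** Homogeneous division by the equations of the point, the remainder being
the projection of the monomial; a product of variables is divided one variable
at a time. *)
Lemma monomial_division P m : exists v w, [/\ bihomog (mbideg m - (1, 0)) v,
  bihomog (mbideg m - (0, 1)) w &
  'X_[m] = mmap1 (base_form P) m + Vx P * v + Vy P * w].
Proof.
elim/mnm_unit_ind: m => [|l m [v [w [vdeg wdeg mE]]]].
  exists 0, 0; split; try exact: bihomog0.
  by rewrite mmap11 mpolyX0 !mulr0 !addr0.
rewrite mbidegD mpolyXD commr_mmap1_M => [|? ?]; last exact: mulrC.
rewrite mmap1U.
have mdeg : bihomog (mbideg m) ('X_[m] : R).
  by move=> m'; rewrite msuppX inE => /eqP->.
have bdeg : bihomog (mbideg U_(l)) (base_form P l).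
  rewrite /base_form mulrC mul_mpolyC /blocks; case: (split_ordP l) => i ->.
    by rewrite mbideg_lshift; apply/bihomogZ/bihomog_Ux.
  by rewrite mbideg_rshift; apply/bihomogZ/bihomog_Uy.
have bv : bihomog (mbideg U_(l) + mbideg m - (1, 0)) (base_form P l * v).
  by rewrite -addrA; apply: bihomogM.
have bw : bihomog (mbideg U_(l) + mbideg m - (0, 1)) (base_form P l * w).
  by rewrite -addrA; apply: bihomogM.
have [c lE] : exists c, 'X_l = base_form P l + blocks (Vx P) (Vy P) l * c%:MP.
  rewrite /base_form /blocks /pt; case: (split_ordP l) => i ->.
    exists (i != pivot P.1)%:R; rewrite row_mxEl -[LHS]/(xvar k i).
    by rewrite [LHS](coord_forms _ P.1) addrC !(mulrC _ _%:MP) !mul_mpolyC.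
  exists (i != pivot P.2)%:R; rewrite row_mxEr -[LHS]/(yvar k i).
  by rewrite [LHS](coord_forms _ P.2) addrC !(mulrC _ _%:MP) !mul_mpolyC.
case: (split_ordP l) => i li.
  exists (base_form P l * v + c *: 'X_[m]), (base_form P l * w); split=> //.
    apply: bihomogD bv _; apply: bihomogZ.
    by rewrite li mbideg_lshift addrAC subrr add0r.
  rewrite {1}lE {1}mE li /blocks (unsplitK (inl i)) -mul_mpolyC mE.
  by ring.
exists (base_form P l * v), (base_form P l * w + c *: 'X_[m]); split=> //.
  apply: bihomogD bw _; apply: bihomogZ.
  by rewrite li mbideg_rshift addrAC subrr add0r.
rewrite {1}lE {1}mE li /blocks (unsplitK (inr i)) -mul_mpolyC mE.
by ring.
Qed.

(** The remainder of the division is a multiple of [f(P)]. *)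
Lemma point_division P q f : bihomog q f -> ev P f = 0 ->
  exists v w, [/\ bihomog (q - (1, 0)) v, bihomog (q - (0, 1)) w &
    f = Vx P * v + Vy P * w].
Proof.
move=> fq f0; have [->|fN0] := eqVneq f 0.
  by exists 0, 0; split; [exact: bihomog0.. | rewrite !mulr0 addr0].
have [a [b qE]] := bihomog_nat fN0 fq; subst q.
have [v vP] := choice (monomial_division P).
have [w wP] := choice vP => {vP}.
exists (\sum_(m <- msupp f) f@_m *: v m), (\sum_(m <- msupp f) f@_m *: w m).
split.
- rewrite big_seq; apply: bihomog_sum => m /fq <-.
  by have [+ _ _] := wP m; apply: bihomogZ.
- rewrite big_seq; apply: bihomog_sum => m /fq <-.
  by have [_ + _] := wP m; apply: bihomogZ.
have base0 : mmap (@mpolyC (2 + 2) k) (base_form P) f = 0.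
  rewrite -[RHS](mulr0 (Ux P ^+ a * Uy P ^+ b)).
  rewrite -[in RHS](rmorph0 (@mpolyC (2 + 2) k)) -f0.
  exact: (mmap_scale (@mpolyC (2 + 2) k) (Ux P) (Uy P) (pt P) fq).
rewrite -[RHS]add0r -[X in _ = X + _]base0 /mmap !mulr_sumr -!big_split.
rewrite [LHS]mpolyE.
apply: eq_bigr => m _; have [_ _ ->] := wP m.
by rewrite -!mul_mpolyC /=; ring.
Qed.

(** The jets at [P] are corrected term by term.  The ideal [K] stands for the
vanishing conditions at the other points; the forms [g], which satisfy these
and do not vanish at [P], kill the leading coefficient of what remains to be
solved. *)
Lemma interpolation_at P (K : submodule R^o) n q d h :
    (forall a b, (a + b < n)%N -> exists g,
       [/\ bihomog (q - (a%:Z, b%:Z)) g, ev P g != 0 & g \in K]) ->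
    bihomog d h -> ev P h != 0 ->
  forall u, bihomog (q + d) u -> exists f,
    [/\ bihomog q f, f \in K & h * f - u \in ideal_pow (point_ideal P) n].
Proof.
move=> Kg hd hP u ud.
(* [t] counts the orders of vanishing still missing, by decreasing induction
   on [a + b]. *)
suff solve t a b v : (t + (a + b))%N = n ->
    bihomog (q + d - (a%:Z, b%:Z)) v -> exists f, [/\ bihomog q f, f \in K &
      h * f - Vx P ^+ a * (Vy P ^+ b * v) \in ideal_pow (point_ideal P) n].
  have [||f fP] := solve n 0%N 0%N u; rewrite ?addn0 ?subr0 //.
  by exists f; rewrite !mul1r in fP.
elim: t a b v => [|t IH] a b v nE vdeg.
  exists 0; split; [exact: bihomog0 | exact: rpred0 |].
  rewrite mulr0 sub0r -mulN1r -nE add0n; apply: mem_idealM.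
  apply: ideal_powX; first exact: Vx_ideal.
  rewrite -[X in ideal_pow _ X]addn0; apply: ideal_powX; first exact: Vy_ideal.
  exact: ideal_pow0.
have [|g [gdeg gP gK]] := Kg a b; first by rewrite -nE; lia.
(* The multiple of [h g] with the value of [v] at [P]. *)
pose c := ev P v / (ev P h * ev P g).
have rdeg : bihomog (q + d - (a%:Z, b%:Z)) (v - c *: (h * g)).
  apply: bihomogB vdeg _; apply: bihomogZ.
  by rewrite [q + d]addrC -addrA; apply: bihomogM.
have r0 : ev P (v - c *: (h * g)) = 0.
  by rewrite mevalB mevalZ mevalM divfK ?subrr // mulf_neq0.
have [v1 [w1 [v1deg w1deg rE]]] := point_division rdeg r0.
have [||f1 [f1q f1K f1P]] := IH a.+1 b v1; first by rewrite -nE; lia.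
  move: v1deg; congr bihomog; case: (q + d) => x y; congr pair; rewrite /=; lia.
have [||f2 [f2q f2K f2P]] := IH a b.+1 w1; first by rewrite -nE; lia.
  move: w1deg; congr bihomog; case: (q + d) => x y; congr pair; rewrite /=; lia.
exists (Vx P ^+ a * (Vy P ^+ b * (c *: g)) + f1 + f2); split.
- by apply: bihomogD f2q; apply: bihomogD f1q; apply/bihomog_VM/bihomogZ.
- apply: rpredD f2K; apply: rpredD f1K; rewrite -mul_mpolyC.
  by do 3!apply: mem_idealM.
have -> : h * (Vx P ^+ a * (Vy P ^+ b * (c *: g)) + f1 + f2)
    - Vx P ^+ a * (Vy P ^+ b * v) =
    (h * f1 - Vx P ^+ a.+1 * (Vy P ^+ b * v1))
    + (h * f2 - Vx P ^+ a * (Vy P ^+ b.+1 * w1)).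
  have -> : v = c *: (h * g) + (Vx P * v1 + Vy P * w1).
    by rewrite -rE addrC subrK.
  by rewrite -!mul_mpolyC !exprS; ring.
exact: rpredD.
Qed.

(** Each point [Q] of multiplicity [n] to be avoided uses up [n] lines through
[Q], of the first ruling as long as there is room, then of the second. *)
Lemma avoiding_form P (r : seq ((P1 k * P1 k) * nat)) (a b : nat) :
    (forall x, x \in r -> (x.1.1 != P.1) && (x.1.2 != P.2)) ->
    (\sum_(x <- r) x.2 <= a + b)%N ->
  exists g, [/\ bihomog (a%:Z, b%:Z) g, ev P g != 0 &
    forall x, x \in r -> g \in ideal_pow (point_ideal x.1) x.2].
Proof.
elim: r a b => [|x r IH] a b rP le_ab.
  exists (Ux P ^+ a * Uy P ^+ b); split=> //.
    have := bihomogM (bihomogX (n := a) (@bihomog_Ux k P))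
      (bihomogX (n := b) (@bihomog_Uy k P)).
    by rewrite !pairMn; congr bihomog; congr pair; rewrite /=; lia.
  by rewrite mevalM !rmorphXn /= ev_Ux ev_Uy !expr1n mulr1 oner_neq0.
rewrite big_cons in le_ab.
have /andP[x1P x2P] := rP x (mem_head _ _).
pose c := minn a x.2.
have [y yr||g [gdeg gP gr]] := IH (a - c)%N (b - (x.2 - c))%N.
- by apply: rP; rewrite inE yr orbT.
- by rewrite /c; lia.
exists (Vx x.1 ^+ c * (Vy x.1 ^+ (x.2 - c) * g)); split.
- apply: bihomog_VM; move: gdeg; congr bihomog; congr pair; rewrite /= /c; lia.
- have Vx0 := ev_Vx_neq0 x1P; have Vy0 := ev_Vy_neq0 x2P.
  by rewrite !mevalM !rmorphXn /= !mulf_neq0 ?expf_neq0.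
move=> y; rewrite inE => /orP[/eqP->|yr]; last first.
  by do 2!apply: mem_idealM; apply: gr.
rewrite -[X in ideal_pow _ X](subnKC (geq_minr a x.2)).
apply: ideal_powX; first exact: Vx_ideal.
rewrite -[X in ideal_pow _ X]addn0; apply: ideal_powX; first exact: Vy_ideal.
exact: ideal_pow0.
Qed.

(** Prescribe the germs [u l / h l] at the points [P l]: the solutions for a
single point which vanish at the others are added up. *)
Lemma interpolation s (P : 'I_s -> P1 k * P1 k) (m : 'I_s -> nat) (i j : nat)
    (P1_inj : injective (fun l => (P l).1))
    (P2_inj : injective (fun l => (P l).2)) :
    (forall l, m l <= i.+1)%N -> (forall l, m l <= j.+1)%N ->
    (\sum_l m l <= (i + j).+1)%N ->
  forall d (h u : 'I_s -> R),
    (forall l, bihomog (d l) (h l)) -> (forall l, ev (P l) (h l) != 0) ->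
    (forall l, bihomog ((i%:Z, j%:Z) + d l) (u l)) ->
  exists2 f, bihomog (i%:Z, j%:Z) f &
    forall l, h l * f - u l \in ideal_pow (point_ideal (P l)) (m l).
Proof.
move=> mi mj mij d h u hd hP ud.
have one l : exists f, [/\ bihomog (i%:Z, j%:Z) f,
    forall l', l' != l -> f \in ideal_pow (point_ideal (P l')) (m l') &
    h l * f - u l \in ideal_pow (point_ideal (P l)) (m l)].
  (* Exponent 0 at [l] gives the unit ideal, that is no condition. *)
  pose K := ideal_cap (fun l' => ideal_pow (point_ideal (P l'))
                                 (if l' == l then 0%N else m l')).
  have [|f [fdeg /forallP fK fl]] :=
      @interpolation_at (P l) K (m l) (i%:Z, j%:Z) (d l) (h l) _
        (hd l) (hP l) _ (ud l).
    move=> a b abm.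
    have [x|| g [gdeg gP gr]] := @avoiding_form (P l)
        [seq (P l', m l') | l' <- enum 'I_s & l' != l] (i - a)%N (j - b)%N.
    - case/mapP => l'; rewrite mem_filter => /andP[l'l _] -> /=.
      by rewrite (inj_eq P1_inj) (inj_eq P2_inj) l'l.
    - rewrite big_map big_filter big_enum_cond /=.
      move: mij (mi l) (mj l); rewrite (bigD1 l) //=.
      by move: (\sum_(_ < s | _) _)%N (m l) abm => S n; lia.
    exists g; split=> //.
      move: gdeg; congr bihomog; congr pair; rewrite /=;
        have := mi l; have := mj l; lia.
    apply/forallP => l'; case: eqP => [_|/eqP l'l]; first exact: ideal_pow0.
    by apply: (gr (P l', m l')); apply/map_f; rewrite mem_filter l'l mem_enum.
  exists f; split=> // l' l'l; have := fK l'.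
  by rewrite (negbTE l'l).
have [f fP] := choice one.
exists (\sum_l f l) => [|l].
  by apply: bihomog_sum => l _; have [] := fP l.
rewrite (bigD1 l) //= mulrDr addrAC; apply: rpredD; first by have [] := fP l.
apply: mem_idealM; apply: rpred_sum => l' l'l.
by have [_ + _] := fP l'; apply; rewrite eq_sym.
Qed.

End Interpolation.

(** * Points in generic position *)

Section GenericPosition.
Import GRing.Theory Num.Theory Order.TTheory.
Local Open Scope ring_scope.
Local Open Scope quotient_scope.
Variable k : closedFieldType.
Local Notation R := {mpoly k[2 + 2]}.
Local Notation ev P f := (f.@[pt P]).

Lemma left_kernel_nonzero (n d : nat) (A : 'M[k]_(n, d)) : (d < n)%N ->
  exists2 v : 'rV_n, v != 0 & v *m A = 0.
Proof.
move=> dn; have : kermx A != 0.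
  rewrite -mxrank_eq0 mxrank_ker -lt0n subn_gt0.
  exact: leq_ltn_trans (rank_leq_col A) dn.
by move=> /rowV0Pn[v vA vN0]; exists v => //; apply/sub_kermxP.
Qed.

Lemma ev_congr p (f : R) (v w : 'I_(2 + 2) -> k) :
    bihomog p f ->
    (forall m l, mbideg m = p -> m l != 0%N -> v l = w l) ->
  f.@[v] = f.@[w].
Proof.
move=> fp vw; rewrite !mevalE big_seq [RHS]big_seq; apply: eq_bigr => m /fp mp.
congr (_ * _); apply: eq_bigr => l _.
by have [->|ml] := eqVneq (m l) 0%N; [rewrite !expr0 | rewrite (vw m)].
Qed.

Section Separation.
Variables (s : nat) (P : 'I_s -> P1 k * P1 k) (i j : nat).
Variable mon : 'I_s -> 'X_{1..2 + 2}.
Hypothesis (P_generic : generic_position P).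
Hypotheses (mon_inj : injective mon)
  (mon_deg : forall l, mbideg (mon l) = (i%:Z, j%:Z)).

Lemma has_dim_lower_bound d :
  has_dim (M := R^o) (bihomog (i%:Z, j%:Z)) d -> (s <= d)%N.
Proof.
move=> [B [_ Bspan]]; rewrite leqNgt; apply/negP => ds.
have mdeg l : bihomog (i%:Z, j%:Z) ('X_[mon l] : R).
  by move=> m; rewrite msuppX inE => /eqP->.
have [c cP] := choice (fun l => Bspan _ (mdeg l)).
have [v vN0 vc] := left_kernel_nonzero (\matrix_(l, t) c l t) ds.
have v0 : \sum_l v 0 l *: ('X_[mon l] : R) = 0.
  transitivity (\sum_t (\sum_l v 0 l * c l t) *: (B t : R)).
    under eq_bigr => l _ do rewrite (proj1 (cP l)) scaler_sumr.
    rewrite exchange_big; apply: eq_bigr => t _; rewrite scaler_suml.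
    by apply: eq_bigr => l _; rewrite -scalerA -[(c l t *: _)]mul_mpolyC.
  apply: big1 => t _.
  have /rowP/(_ t) := vc; rewrite !mxE => vct.
  rewrite (_ : \sum_l v 0 l * c l t = 0) ?scale0r // -[RHS]vct.
  by apply: eq_bigr => l _; rewrite mxE.
case/eqP: vN0; apply/rowP => l; rewrite mxE.
have := congr1 (mcoeff (mon l)) v0.
rewrite raddf_sum mcoeff0 (bigD1 l) //= big1 => [|l' l'l].
  by rewrite mcoeffZ mcoeffX eqxx mulr1 addr0.
by rewrite mcoeffZ mcoeffX (inj_eq mon_inj) (negbTE l'l) mulr0.
Qed.

(** If all the forms of degree [(i, j)] had equal values at [P a] and [P b],
then the vanishing at the points other than [P b] would already put a form in
the ideal of the support: this gives [s - 1] linear conditions, too few for a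
quotient of dimension [s]. *)
Lemma generic_separation (a b : 'I_s) : a != b ->
  exists2 f, bihomog (i%:Z, j%:Z) f & ev (P a) f != ev (P b) f.
Proof.
move=> ab; have [d [/has_dim_lower_bound sd]] := P_generic i j.
move=> [C [Cdeg Cuniq]].
have [f fP] := choice Cdeg.
have [v vN0 vA] := @left_kernel_nonzero (minn d s) s.-1
  (col' b (\matrix_(l, q) ev (P q) (f l))) ltac:(have := ltn_ord a; lia).
apply: contrapT => nosep.
have same g : bihomog (i%:Z, j%:Z) g -> ev (P a) g = ev (P b) g.
  by move=> gdeg; apply: contrapT => /eqP ne; apply: nosep; exists g.
pose F : R := \sum_l v 0 l *: (f l : R).
have Fdeg : bihomog (i%:Z, j%:Z) F.
  by apply: bihomog_sum => l _; apply: bihomogZ; have [] := fP l.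
have Fq q : q != b -> ev (P q) F = 0.
  rewrite eq_sym => /unlift_some[q' qE _].
  have /rowP/(_ q') := vA; rewrite !mxE => <-.
  rewrite /F rmorph_sum; apply: eq_bigr => l _.
  by rewrite /= mevalZ !mxE qE.
have F0 q : ev (P q) F = 0.
  by have [->|/Fq//] := eqVneq q b; rewrite -same // Fq.
have [c [_ cuniq]] : exists! c : {ffun _ -> k}, 0 = \sum_l (c l)%:MP *: C l.
  by apply: Cuniq; exists 0; split; [exact: bihomog0 | rewrite raddf0].
case/eqP: vN0; apply/rowP => l; rewrite mxE.
have c0 : c = [ffun=> 0].
  apply: cuniq; rewrite big1 // => l' _.
  by rewrite ffunE mpolyC0 scale0r.
have : c = [ffun l => v 0 l].
  apply: cuniq; transitivity (\pi_{ideal_quot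
      (ideal_cap (fun l => point_ideal (P l)))} F).
    apply/esym/eqP; rewrite pi_eq0; apply/forallP => q.
    exact: (mem_point_ideal Fdeg).
  rewrite /F raddf_sum; apply: eq_bigr => l' _.
  have [_ ->] := fP l'; rewrite ffunE -mul_mpolyC.
  by apply/esym; exact: quot_scaleE.
by rewrite c0 => /ffunP/(_ l); rewrite !ffunE.
Qed.

End Separation.

(** There are [s] monomials of degree [(s - 1, 0)], so forms of this degree
separate the points; but they only see first coordinates. *)
Lemma generic_coord_inj s (P : 'I_s -> P1 k * P1 k) : generic_position P ->
  injective (fun l => (P l).1) /\ injective (fun l => (P l).2).
Proof.
move=> Pgen.
pose mon (phi : 'I_2 -> 'I_(2 + 2)) (l : 'I_s) : 'X_{1..2 + 2} :=
  (U_(phi 0%R) *+ l + U_(phi 1%R) *+ (s.-1 - l))%MM.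
have mon_inj phi : injective phi -> injective (mon phi).
  move=> phi_inj l l' /mnmP/(_ (phi 0)); rewrite !mnmDE !mulmnE !mnm1E eqxx.
  by rewrite (inj_eq phi_inj) /= !mul0n !mul1n !addn0 => /val_inj.
split=> a b Pab; apply/eqP; apply: contraPT (erefl true) => ab.
  have mon_deg l : mbideg (mon (lshift 2) l) = (s.-1%:Z, 0%:Z).
    rewrite /mbideg !big_ord_recl !big_ord0 !mnmDE !mulmnE !mnm1E.
    rewrite ?eq_lshift ?eq_lrshift /=.
    by have ls := ltn_ord l; congr pair; lia.
  have [f fdeg] :=
    generic_separation Pgen (mon_inj _ (@lshift_inj _ _)) mon_deg ab.
  case/eqP; apply: (ev_congr fdeg) => m l [_ my] ml.
  rewrite /pt; case: (split_ordP l) => i lE; rewrite lE ?row_mxEl ?row_mxEr.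
    by rewrite Pab.
  by move: ml my; rewrite lE (bigD1 i) //= => /eqP; lia.
have mon_deg l : mbideg (mon (@rshift 2 2) l) = (0%:Z, s.-1%:Z).
  rewrite /mbideg !big_ord_recl !big_ord0 !mnmDE !mulmnE !mnm1E.
  rewrite ?eq_rshift ?eq_rlshift /=.
  by have ls := ltn_ord l; congr pair; lia.
have [f fdeg] :=
  generic_separation Pgen (mon_inj _ (@rshift_inj _ _)) mon_deg ab.
case/eqP; apply: (ev_congr fdeg) => m l [mx _] ml.
rewrite /pt; case: (split_ordP l) => i lE; rewrite lE ?row_mxEl ?row_mxEr.
  by move: ml mx; rewrite lE (bigD1 i) //= => /eqP; lia.
by rewrite Pab.
Qed.

End GenericPosition.

(** * Local cohomology of the fat points *)

Section LocalCohomology.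
Import GRing.Theory Num.Theory Order.TTheory.
Local Open Scope ring_scope.
Variable k : closedFieldType.
Local Notation ev P f := (f.@[pt P]).

Lemma irrelevant_genP l : exists i j, irrelevant_gen k l = xvar k i * yvar k j.
Proof.
rewrite /irrelevant_gen (tnth_nth 0).
by case: l => [[|[|[|[|//]]]] ?] /=; do 2 eexists.
Qed.

Lemma irrelevant_gen_index i j :
  exists l, irrelevant_gen k l = xvar k i * yvar k j.
Proof.
case: i => [[|[|//]] lti]; case: j => [[|[|//]] ltj];
  [exists (inord 0) | exists (inord 1) | exists (inord 2) | exists (inord 3)];
  rewrite /irrelevant_gen (tnth_nth 0) inordK //=;
  by congr (_ _ * _ _); apply: val_inj.
Qed.

Lemma bihomog_irrelevant_gen l : bihomog (1, 1) (irrelevant_gen k l).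
Proof.
have [i [j ->]] := irrelevant_genP l.
exact: (bihomogM (@bihomog_xvar k i) (@bihomog_yvar k j)).
Qed.

Lemma sum_bidegree r (sigma : {set 'I_r}) :
  \sum_(l in sigma) ((1, 1) : int * int) = (#|sigma|%:Z, #|sigma|%:Z).
Proof. by rewrite sumr_const pairMn; congr pair; lia. Qed.

(** The degree [p] matters only for [H^1]: higher cohomology involves degrees
[p + c (1, 1)] with [c] arbitrarily large. *)
Lemma lc_vanishes_fat s (m : 'I_s -> nat) (P : 'I_s -> P1 k * P1 k)
    (jj : nat) (p : int * int) (i j : nat) :
    injective (fun l => (P l).1) -> injective (fun l => (P l).2) ->
    (forall l, m l <= i.+1)%N -> (forall l, m l <= j.+1)%N ->
    (\sum_l m l <= (i + j).+1)%N ->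
    (jj = 1%N -> i%:Z <= p.1 /\ j%:Z <= p.2) ->
  lc_vanishes (quot_bihomog (I := fat_ideal m P)) jj p.
Proof.
move=> P1_inj P2_inj mi mj mij pij.
have tex (Q : P1 k * P1 k) : exists l, ev Q (irrelevant_gen k l) != 0.
  have [l lE] := irrelevant_gen_index (pivot Q.1) (pivot Q.2).
  exists l; rewrite lE mevalM ev_xvar ev_yvar.
  by apply: mulf_neq0; exact: rep_pivot.
have [t tP] := choice tex.
apply: (@cech_vanishing _ _ _ (irrelevant_gen k)
  (fun l => ideal_pow (point_ideal (P l)) (m l)) (fun l => t (P l)) _
  (@bihomog k)).
- by move=> q; exact: bihomog0.
- move=> q n f fq; rewrite -signr_odd; case: odd.
    by rewrite expr1 mulN1r; have := bihomogZ (c := -1) fq; rewrite scaleN1r.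
  by rewrite mul1r.
- move=> q l f fq; rewrite addrC.
  exact: (bihomogM (@bihomog_irrelevant_gen l) fq).
- move=> Q l; have [g0|gN0] := eqVneq (ev (P Q) (irrelevant_gen k l)) 0;
    last first.
    by left => f; exact: (ideal_pow_primary gN0).
  right; exists (m Q); rewrite -[_ ^+ _]mulr1 -[X in ideal_pow _ X]addn0.
  apply: ideal_powX; last exact: ideal_pow0.
  exact: (mem_point_ideal (@bihomog_irrelevant_gen l)).
- by move=> Q f; exact: (ideal_pow_primary (tP (P Q))).
(* From this exponent on, [p + a (c, c) >= (i, j)] for all [c >= 1]. *)
exists (`|p.1| + `|p.2| + i + j)%N => a sigma aP sj u udeg.
have [i' [j' [qE ii' jj']]] : exists i' j' : nat,
    [/\ p + (\sum_(l in sigma) ((1, 1) : int * int)) *+ a = (i'%:Z, j'%:Z),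
      (i <= i')%N & (j <= j')%N].
  rewrite sum_bidegree pairMn; move: sj; case: #|sigma| => [|c] sj.
    have [pi pj] := pij (esym sj).
    exists `|p.1|%N, `|p.2|%N; split; [|lia|lia].
    case: (p) pi pj => p1 p2 /= pi pj; congr pair; rewrite /= mul0rn; lia.
  exists (absz (p.1 + c.+1%:Z *+ a)), (absz (p.2 + c.+1%:Z *+ a)).
  have ac : a%:Z <= c.+1%:Z *+ a by rewrite -mulr_natr natz; nia.
  case: (p) aP => p1 p2 /= aP; split; [|lia|lia].
  by congr pair; rewrite /=; lia.
rewrite qE in udeg *.
apply: (interpolation P1_inj P2_inj (m := m) _ _ _
   (d := fun Q => (1, 1) *+ a)
   (h := fun Q => irrelevant_gen k (t (P Q)) ^+ a)) => //.
- by move=> l; apply: leq_trans (mi l) _.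
- by move=> l; apply: leq_trans (mj l) _.
- by apply: leq_trans mij _; rewrite ltnS leq_add.
- by move=> l; apply: bihomogX; exact: bihomog_irrelevant_gen.
by move=> l; rewrite rmorphXn /=; apply: expf_neq0; exact: tP.
Qed.

End LocalCohomology.

Theorem theorem5p1 (k : closedFieldType) (k_char0 : [pchar k]%R =i pred0)
    (s : nat) (s_gt0 : 0 < s) (P : 'I_s -> P1 k * P1 k) (P_inj : injective P)
    (m : 'I_s -> nat) (m_gt0 : forall l, 0 < m l)
    (P_generic : generic_position P)
    (m_noninc : forall a b : 'I_s, a <= b -> m b <= m a) :
  let m1 := m (Ordinal s_gt0) in
  let mtot := \sum_(l < s) m l in
  forall i j : nat,
    m1 - 1 <= i -> m1 - 1 <= j -> maxn (mtot - 1) (2 * m1 - 2) <= i + j ->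
    regB m P (Posz i, Posz j).
Proof.
move=> m1 mtot i j m1i m1j mij jj p [[q1 q2] /= [q_sum [qp1 qp2]]].
have [P1_inj P2_inj] := generic_coord_inj P_generic.
have m_le l : m l <= m1 by exact: m_noninc.
apply: (lc_vanishes_fat P1_inj P2_inj (i := i) (j := j)).
- by move=> l; have := m_le l; lia.
- by move=> l; have := m_le l; lia.
- by rewrite -/mtot; lia.
move=> jj1; move: q_sum qp1 qp2; rewrite jj1 /=.
case: (p) => p1 p2 /=; rewrite /GRing.add /=; lia.
Qed.
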